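(* Let $P$ be a naturally labeled poset on $\{1,\ldots,n\}$ and let $C_1,\ldots,C_h$ be the connected components of the graph $G_P$. Let $1\le r\le h$ and let $M_r$ be a maximum independent set of $C_r$. Then for any two maximum independent sets $M^1,M^2$ of $G_P$ with $M^1\cap V(C_r)=M^2\cap V(C_r)=M_r$, we have $\mathrm{Des}(M_r,M^1)=\mathrm{Des}(M_r,M^2)$ and $\overline{\mathrm{Des}}(M_r,M^1)=\overline{\mathrm{Des}}(M_r,M^2)$.
   Context: $P$ is a partial order $\leq_P$ on $[n]=\{1,\ldots,n\}$; it is naturally labeled if $i<_P j$ implies $i<j$. An order ideal is a subset $J$ with $i\in J$, $j\leq_P i\Rightarrow j\in J$; a nonempty order ideal is connected if the Hasse diagram of $P$ restricted to it is connected. Sets $A,B$ intersect nontrivially if $A\cap B\ne\emptyset$, $A\not\subseteq B$, $B\not\subseteq A$. $G_P$ is the simple graph whose vertices are the connected order ideals of $P$, adjacent iff they intersect nontrivially; $V(C)$ denotes the vertex set of a subgraph $C$. A maximum independent set is an independent set (pairwise non-adjacent vertices) of largest possible size. For a maximum independent set $M$ of $G_P$ and $J\in M$ let $\mu(M,J)=\bigcup_{J'\in M,\,J'\subsetneq J}J'$. It is a fact (established in the paper) that for each $J\in M$, $J\setminus\mu(M,J)$ is a single element and distinct $J\in M$ give distinct elements, so each $i\in[n]$ corresponds to a unique $J_i\in M$ with $J_i\setminus\mu(M,J_i)=\{i\}$. Let $F_M$ be the poset on $[n]$ with $i<_{F_M}j$ iff $J_i\subsetneq J_j$; it is a forest (each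 element covered by at most one element, called its parent). For a forest $F$ on $[n]$, $\mathrm{Des}(F)=\{i : \text{the parent } j \text{ of } i \text{ satisfies } i>j\}$. Set $\mathrm{Des}(M)=\mathrm{Des}(F_M)$. For a maximum independent set $M_r$ of $C_r$ and a maximum independent set $M$ of $G_P$ with $M\cap V(C_r)=M_r$, define $\mathrm{Des}(M_r,M)=\{i\in\mathrm{Des}(M) : \{i\}=J\setminus\mu(M,J)\text{ for some }J\in M_r\}$ and $\overline{\mathrm{Des}}(M_r,M)=\{J\in M_r : J\setminus\mu(M,J)=\{i\}\text{ for some } i\in\mathrm{Des}(M_r,M)\}$. *)

(* Defs.v *)
From mathcomp Require Import all_boot.

Set Implicit Arguments.
Unset Strict Implicit.
Unset Printing Implicit Defensive.

(** The ground set [n] = {1, ..., n} is represented by 'I_n, the label k being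
    the ordinal k - 1; only comparisons between labels matter below. *)

Section SimpleGraphs.

Variable T : finType.

Record sgraph := SGraph {
  vert : {set T};
  edge : rel T;
  edge_sym : symmetric edge;
  edge_irr : irreflexive edge;
  edge_vert : forall x y, edge x y -> x \in vert
}.

Definition induced_edge (A : {set T}) (e : rel T) : rel T :=
  fun x y => [&& x \in A, y \in A & e x y].

Lemma induced_edge_sym A e : symmetric e -> symmetric (induced_edge A e).
Proof. by move=> es x y; rewrite /induced_edge es andbCA. Qed.

Lemma induced_edge_irr A e : irreflexive e -> irreflexive (induced_edge A e).
Proof. by move=> ei x; rewrite /induced_edge ei !andbF. Qed.

Lemma induced_edge_vert A e x y : induced_edge A e x y -> x \in A.
Proof. by case/and3P. Qed.

Definition mk_sgraph (A : {set T}) (e : rel T)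
    (es : symmetric e) (ei : irreflexive e) : sgraph :=
  SGraph (@induced_edge_sym A e es) (@induced_edge_irr A e ei)
         (@induced_edge_vert A e).

Definition induced (G : sgraph) (A : {set T}) : sgraph :=
  mk_sgraph (vert G :&: A) (@edge_sym G) (@edge_irr G).

Definition connected (G : sgraph) : bool :=
  (vert G != set0) &&
  [forall x in vert G, forall y in vert G, connect (edge G) x y].

Definition component_sets (G : sgraph) : {set {set T}} :=
  equivalence_partition (connect (edge G)) (vert G).

Definition independent (G : sgraph) (S : {set T}) : Prop :=
  S \subset vert G /\ {in S &, forall x y, ~~ edge G x y}.

Definition maximum_independent (G : sgraph) (S : {set T}) : Prop :=
  independent G S /\ forall S', independent G S' -> #|S'| <= #|S|.

End SimpleGraphs.

Section Posets.

Variable n : nat.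

Definition partial_order (le : rel 'I_n) : Prop :=
  [/\ reflexive le, antisymmetric le & transitive le].

Definition strict (le : rel 'I_n) : rel 'I_n :=
  fun i j => (i != j) && le i j.

Definition naturally_labeled (le : rel 'I_n) : Prop :=
  forall i j : 'I_n, strict le i j -> i < j.

Definition covered_by (lt : rel 'I_n) : rel 'I_n :=
  fun i j => lt i j && ~~ [exists k, lt i k && lt k j].

Definition hasse_edge (le : rel 'I_n) : rel 'I_n :=
  fun i j => covered_by (strict le) i j || covered_by (strict le) j i.

Lemma hasse_edge_sym le : symmetric (hasse_edge le).
Proof. by move=> i j; rewrite /hasse_edge orbC. Qed.

Lemma hasse_edge_irr le : irreflexive (hasse_edge le).
Proof. by move=> i; rewrite /hasse_edge /covered_by /strict eqxx. Qed.

Definition hasse (le : rel 'I_n) : sgraph 'I_n :=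
  mk_sgraph setT (@hasse_edge_sym le) (@hasse_edge_irr le).

Definition order_ideal (le : rel 'I_n) (J : {set 'I_n}) : bool :=
  [forall i in J, forall j, le j i ==> (j \in J)].

Definition connected_ideals (le : rel 'I_n) : {set {set 'I_n}} :=
  [set J | order_ideal le J && connected (induced (hasse le) J)].

Definition meet_nontrivially : rel {set 'I_n} :=
  fun A B => [&& A :&: B != set0, ~~ (A \subset B) & ~~ (B \subset A)].

Lemma meet_nontrivially_sym : symmetric meet_nontrivially.
Proof. by move=> A B; rewrite /meet_nontrivially setIC; congr andb; rewrite andbC. Qed.

Lemma meet_nontrivially_irr : irreflexive meet_nontrivially.
Proof. by move=> A; rewrite /meet_nontrivially subxx andbF. Qed.

Definition ideal_graph (le : rel 'I_n) : sgraph {set 'I_n} :=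
  mk_sgraph (connected_ideals le) meet_nontrivially_sym meet_nontrivially_irr.

Implicit Types (M Mr : {set {set 'I_n}}) (J : {set 'I_n}).

Definition mu M J : {set 'I_n} := \bigcup_(J' in M | J' \proper J) J'.

(** The ideal J_i of M. When M is a maximum independent set of the ideal graph
    exactly one J in M qualifies, so the default value set0 is never used. *)
Definition ideal_of M (i : 'I_n) : {set 'I_n} :=
  odflt set0 [pick J in M | J :\: mu M J == [set i]].

Definition forest_lt M : rel 'I_n :=
  fun i j => ideal_of M i \proper ideal_of M j.

(** The parent of i in a forest is the element covering i. *)
Definition forest_Des (lt : rel 'I_n) : {set 'I_n} :=
  [set i : 'I_n | [exists j : 'I_n, covered_by lt i j && (j < i)]].

Definition Des M : {set 'I_n} := forest_Des (forest_lt M).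

Definition Des_rel Mr M : {set 'I_n} :=
  [set i in Des M | [exists J in Mr, [set i] == J :\: mu M J]].

Definition Desbar_rel Mr M : {set {set 'I_n}} :=
  [set J in Mr | [exists i in Des_rel Mr M, J :\: mu M J == [set i]]].

End Posets.

(* Main.v *)
(** Call a connected ideal isolated when it has no neighbour in the ideal graph;
    isolated ideals belong to every maximum independent set. If [A] is contained
    in a vertex [B] of another component, then so is every vertex of the component
    of [A]; hence the union [U] of the vertices of a component is an isolated
    connected ideal.

    If [C] is a single isolated ideal [J] with label [i] and the parent of [i] is
    [j], then connectedness puts [j] above some element of [J], and isolation puts
    the whole of [J] below [j]; as the labeling is natural, [i] is not a descent.

    Otherwise [U] is not in [C] and, for [J] in [C] or [J = U], a member of [M]
    strictly inside [J] is either in [C] or contained in the union of its component,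
    which is isolated and strictly inside [J]. Hence [mu M J] depends only on the
    trace of [M] on [C]. The parent of a member of this trace is again in [C] or
    equal to [U], so descents depend only on the trace as well. *)
Require Import Defs.
From mathcomp Require Import all_boot.

Set Implicit Arguments.
Unset Strict Implicit.
Unset Printing Implicit Defensive.

Section IdealGraph.

Variables (n : nat) (le : rel 'I_n).
Hypotheses (le_po : partial_order le) (le_nat : naturally_labeled le).

Implicit Types (i j k : 'I_n) (A B E F J K L : {set 'I_n}).
Implicit Types (M : {set {set 'I_n}}).

Local Notation V := (connected_ideals le).
Local Notation adj := (edge (ideal_graph le)).

Let le_refl : reflexive le. Proof. by case: le_po. Qed.
Let le_trans : transitive le. Proof. by case: le_po. Qed.

(** * Connectedness of order ideals *)

Lemma order_idealP J :
  reflect (forall i j, i \in J -> le j i -> j \in J) (order_ideal le J).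
Proof.
apply: (iffP forall_inP) => [h i j iJ ji | h i iJ].
  by move/(_ i iJ)/forallP/(_ j): h; rewrite ji.
by apply/forallP => j; apply/implyP; apply: h.
Qed.

Lemma le_natural i j : le i j -> i <= j.
Proof.
move=> ij; have [->//|ne] := eqVneq i j.
by apply/ltnW/le_nat; rewrite /strict ne.
Qed.

(** The form of connectedness used below, free of Hasse paths. *)
Definition unsplit J : Prop :=
  forall K L, order_ideal le K -> order_ideal le L -> [disjoint K & L] ->
    J \subset K :|: L -> J \subset K \/ J \subset L.

(** Induction on the difference of labels: an element strictly between [i] and [j] has an
    intermediate label, and without one the pair is a Hasse edge. *)
Lemma strict_connect_hasse J i j :
  order_ideal le J -> j \in J -> strict le i j ->
  connect (edge (induced (hasse le) J)) i j.
Proof.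
move=> /order_idealP idJ.
have [m] := ubnP (j - i); elim: m i j => // m IH i j; rewrite ltnS => le_m jJ ij.
have iJ : i \in J by case/andP: ij => _; apply: idJ.
have [/existsP[k /andP[ik kj]]|ncov] :=
  boolP [exists k, strict le i k && strict le k j]; last first.
  apply: connect1; rewrite /= /induced_edge !inE iJ jJ /=.
  by rewrite /hasse_edge /covered_by ij ncov.
have kJ : k \in J by case/andP: kj => _; apply: idJ.
have lik := le_nat ik; have lkj := le_nat kj.
apply: (connect_trans (y := k)); apply: IH => //; apply: leq_trans le_m.
  by apply: ltn_sub2r; rewrite // (ltn_trans lik).
by apply: ltn_sub2l; rewrite // (ltn_trans lik).
Qed.

(** An order ideal containing the upper end of a Hasse edge contains the lower end, so no edge joins
    disjoint order ideals. Conversely, the part of [J] reachable from a point and the rest of [J]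
    are disjoint order ideals. *)
Lemma connected_idealsP J :
  J \in V <-> [/\ order_ideal le J, J != set0 & unsplit J].
Proof.
rewrite inE /connected /= !setTI; split.
  case/and3P => idJ J0 /forall_inP conJ; split=> // K L idK idL dKL sJ.
  case/set0Pn: J0 => x xJ.
  suff gen A B : order_ideal le A -> order_ideal le B -> [disjoint A & B] ->
      J \subset A :|: B -> x \in A -> J \subset A.
    case/setUP: (subsetP sJ x xJ) => xK; [left|right].
      exact: (gen K L).
    by apply: (gen L K) => //; rewrite 1?disjoint_sym 1?setUC.
  move=> /order_idealP idA /order_idealP idB dAB sJAB xA.
  apply/subsetP => y yJ.
  have /forall_inP/(_ y yJ) := conJ x xJ.
  have clA : closed (edge (induced (hasse le) J)) A.
    apply: intro_closed.
      exact: sym_connect_sym (@edge_sym _ _).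
    move=> a b /= /and3P[]; rewrite !inE => _ bJ /and3P[_ _ /orP[]] /andP[/andP[_ ab] _] aA.
      case/setUP: (subsetP sJAB b bJ) => // bB.
      by have := disjointFr dAB aA; rewrite (idB b a).
    exact: idA ab.
  rewrite /induced /= setTI in clA.
  by move=> /(closed_connect clA) <-.
case=> idJ J0 uJ; rewrite idJ J0 /=.
apply/forall_inP => x xJ; apply/forall_inP => y yJ.
have symc : connect_sym (edge (induced (hasse le) J)).
  exact: sym_connect_sym (@edge_sym _ _).
rewrite /induced /= setTI in symc *.
set e := induced_edge J _ in symc *.
have hc i j : j \in J -> le i j -> connect e i j.
  move=> jJ ij; have [->|ne] := eqVneq i j; first exact: connect0.
  have := @strict_connect_hasse J i j idJ jJ.
  by rewrite /induced /= setTI; apply; rewrite /strict ne.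
pose K := [set z in J | connect e x z]; pose L := [set z in J | ~~ connect e x z].
have /order_idealP idJ' := idJ.
have idK : order_ideal le K.
  apply/order_idealP => i j; rewrite !inE => /andP[iJ xi] ji.
  rewrite (idJ' i) //=; apply: connect_trans xi _; rewrite symc; exact: hc.
have idL : order_ideal le L.
  apply/order_idealP => i j; rewrite !inE => /andP[iJ xi] ji.
  rewrite (idJ' i) //=; apply: contra xi => xj.
  by apply: connect_trans xj _; exact: hc.
have dKL : [disjoint K & L].
  rewrite -setI_eq0; apply/eqP/setP => z; rewrite !inE.
  by case: (connect e x z); rewrite ?andbF.
have sJ : J \subset K :|: L.
  by apply/subsetP => z zJ; rewrite !inE zJ; case: connect.
case: (uJ K L idK idL dKL sJ) => /subsetP s.
  by have := s y yJ; rewrite inE => /andP[].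
by have := s x xJ; rewrite inE connect0 andbF.
Qed.

Lemma ideal_nonempty J : J \in V -> exists i, i \in J.
Proof. by case/connected_idealsP => _ /set0Pn. Qed.

Lemma principal_ideal_connected j : [set i | le i j] \in V.
Proof.
apply/connected_idealsP; split.
- by apply/order_idealP => a b; rewrite !inE => aj ba; apply: le_trans ba aj.
- by apply/set0Pn; exists j; rewrite inE.
move=> K L /order_idealP idK /order_idealP idL _ s.
have /(subsetP s)/setUP[jK|jL] : j \in [set i | le i j] by rewrite inE.
  by left; apply/subsetP => i; rewrite inE; apply: idK.
by right; apply/subsetP => i; rewrite inE; apply: idL.
Qed.

(** * Components of the ideal graph and their unions *)

Lemma adjE A B : adj A B = [&& A \in V, B \in V & meet_nontrivially A B].
Proof. by []. Qed.

Lemma nonadj_nested A B : A \in V -> B \in V -> ~~ adj A B ->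
  A :&: B != set0 -> A \subset B \/ B \subset A.
Proof.
move=> AV BV; rewrite adjE AV BV /= /meet_nontrivially => + AB; rewrite AB /=.
by case: (A \subset B); [left | case: (B \subset A); [right|]].
Qed.

Lemma adj_connect_sym : connect_sym adj.
Proof. exact: sym_connect_sym (@edge_sym _ _). Qed.

Lemma connect_adj_vert E F : E \in V -> connect adj E F -> F \in V.
Proof.
move=> EV; rewrite adj_connect_sym => /connectP[p pth eE].
by case: p pth eE => [_ /= <-//|G p] /= /andP[/and3P[]].
Qed.

(** Along a path out of [E], the next vertex [G] meets [B] without being adjacent to it; the
    alternative [B \subset G] would put [E] inside its neighbour [G]. *)
Lemma component_sub E F B : E \in V -> B \in V -> ~~ connect adj E B ->
  connect adj E F -> E \subset B -> F \subset B.
Proof.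
move=> EV BV nEB /connectP[p pth ->] {F}.
elim: p E EV nEB pth => //= G p IH E EV nEB /andP[EG pth] sEB.
have nGB : ~~ connect adj G B.
  by apply: contra nEB; apply: connect_trans; apply: connect1.
have GV : G \in V by case/and3P: EG.
apply: IH => //.
case/and3P: EG => _ _ /and3P[/set0Pn[x /setIP[xE xG]] nEG _].
case: (@nonadj_nested G B GV BV).
- by apply: contra nGB; apply: connect1.
- by apply/set0Pn; exists x; rewrite inE xG (subsetP sEB).
- by [].
by move=> sBG; rewrite (subset_trans sEB sBG) in nEG.
Qed.

Definition component_union E : {set 'I_n} := \bigcup_(F | connect adj E F) F.

Lemma sub_component_union E F : connect adj E F -> F \subset component_union E.
Proof. by move=> EF; apply: bigcup_sup. Qed.

(** Adjacent vertices overlap, so all vertices along a path fall into the same one of two disjoint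
    order ideals. *)
Lemma component_union_connected E : E \in V -> component_union E \in V.
Proof.
move=> EV; apply/connected_idealsP; split.
- apply/order_idealP => i j /bigcupP[F EF iF] ji.
  apply/bigcupP; exists F => //.
  have /connected_idealsP[/order_idealP idF _ _] := connect_adj_vert EV EF.
  exact: idF ji.
- have [x xE] := ideal_nonempty EV.
  by apply/set0Pn; exists x; apply/bigcupP; exists E.
move=> K L idK idL dKL /bigcupsP sU.
have gen A B : order_ideal le A -> order_ideal le B -> [disjoint A & B] ->
    (forall F, connect adj E F -> F \subset A :|: B) ->
    E \subset A -> component_union E \subset A.
  move=> idA idB dAB {}sU sEA; apply/bigcupsP => F /connectP[p pth ->] {F}.
  elim: p E EV sU pth sEA => //= G p IH H HV sU /andP[HG pth] sHA.
  case/and3P: (HG) => _ GV /and3P[/set0Pn[x /setIP[xH xG]] _ _].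
  apply: (IH G) => //.
    by move=> F GF; apply: sU; apply: connect_trans GF; apply: connect1.
  have /connected_idealsP[_ _ /(_ A B idA idB dAB)] := GV.
  case=> //; first by apply: sU; apply: connect1.
  move=> sGB; have := disjointFr dAB (subsetP sHA x xH).
  by rewrite (subsetP sGB).
have /connected_idealsP[_ _ /(_ K L idK idL dKL)] := EV.
case; first exact: sU.
  by left; apply: (gen K L).
by right; apply: (gen L K) => //; rewrite 1?disjoint_sym // setUC.
Qed.

Definition isolated J : Prop := J \in V /\ forall B, ~~ adj J B.

(** A vertex [B] outside the component that meets the union is nested with some [F] of the
    component: it lies in [F], or it contains [F] and then, by [component_sub], the whole union. *)
Lemma component_union_isolated E : E \in V -> isolated (component_union E).
Proof.
move=> EV; split; first exact: component_union_connected.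
move=> B; apply/negP => /and3P[_ BV /and3P[/set0Pn[x /setIP[]]]].
case/bigcupP => F EF xF xB nUB nBU.
have FV := connect_adj_vert EV EF.
have nEB : ~~ connect adj E B.
  by apply: contra nBU; apply: sub_component_union.
have nFB : ~~ connect adj F B by apply: contra nEB; apply: connect_trans.
case: (@nonadj_nested F B FV BV).
- by apply: contra nFB; apply: connect1.
- by apply/set0Pn; exists x; rewrite inE xF.
- move=> sFB; case/negP: nUB; apply/bigcupsP => G EG.
  apply: (@component_sub F) => //.
  by apply: connect_trans EG; rewrite adj_connect_sym.
by move=> sBF; rewrite (subset_trans sBF (sub_component_union EF)) in nBU.
Qed.

Lemma isolated_nested J B : isolated J -> B \in V -> J :&: B != set0 ->
  J \subset B \/ B \subset J.
Proof. by case=> JV nJ BV; apply: nonadj_nested. Qed.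

Lemma isolated_connect J B : isolated J -> connect adj J B -> B = J.
Proof.
case=> _ nJ /connectP[[_ -> //|G p] /= /andP[JG _] _].
by case/negP: (nJ G).
Qed.

(** ** Maximum independent sets *)

(** Adding an isolated vertex keeps a set independent. *)
Lemma isolated_in_maximum M J :
  maximum_independent (ideal_graph le) M -> isolated J -> J \in M.
Proof.
case=> [[sM indM] maxM] [JV nJ]; apply/negPn/negP => JM.
suff /maxM : independent (ideal_graph le) (J |: M) by rewrite cardsU1 JM ltnn.
split; first by rewrite subUset sub1set JV.
move=> A B /setU1P[->|AM] /setU1P[->|BM] //; last exact: indM.
by rewrite edge_sym.
Qed.

(** * A lower bound on the size of maximum independent sets *)

Definition prefix_adj i : rel 'I_n :=
  fun a b => [&& a <= i, b <= i & le a b || le b a].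

(** The connected component of [i] in the ideal of the elements labeled at
    most [i]. *)
Definition prefix_component i : {set 'I_n} := [set y | connect (prefix_adj i) i y].

Lemma prefix_adj_sym i : symmetric (prefix_adj i).
Proof. by move=> a b; rewrite /prefix_adj andbCA orbC. Qed.

Lemma prefix_component_le i y : y \in prefix_component i -> y <= i.
Proof.
rewrite inE (sym_connect_sym (@prefix_adj_sym i)) => /connectP[p pth ei].
by case: p pth ei => [_ /= <-//|z p] /= /andP[/and3P[]].
Qed.

Lemma prefix_component_connected i : prefix_component i \in V.
Proof.
have ii : i \in prefix_component i by rewrite inE.
apply/connected_idealsP; split.
- apply/order_idealP => a b aJ ba; have ai := prefix_component_le aJ.
  move: aJ; rewrite !inE => ia; apply: connect_trans ia (connect1 _).
  by rewrite /prefix_adj ai ba orbT (leq_trans (le_natural ba)).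
- by apply/set0Pn; exists i.
have gen A B : order_ideal le A -> order_ideal le B -> [disjoint A & B] ->
    prefix_component i \subset A :|: B -> i \in A -> prefix_component i \subset A.
  move=> /order_idealP idA /order_idealP idB dAB sAB iA.
  apply/subsetP => y; rewrite inE => /connectP[p pth ->] {y}.
  elim/last_ind: p pth => //= p z IH; rewrite rcons_path last_rcons => /andP[pth].
  have lJ : last i p \in prefix_component i by rewrite inE; apply/connectP; exists p.
  move=> ez; have lA := IH pth.
  have /(subsetP sAB)/setUP[//|zB] : z \in prefix_component i.
    by move: lJ; rewrite !inE => lJ; apply: connect_trans lJ (connect1 ez).
  case/and3P: ez => _ _ /orP[lz|]; last exact: idA.
  by have := disjointFr dAB lA; rewrite (idB z).
move=> K L idK idL dKL s; case/setUP: (subsetP s i ii) => ?; [left|right].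
  exact: (gen K L).
by apply: (gen L K) => //; rewrite 1?disjoint_sym // setUC.
Qed.

Lemma prefix_component_inj : injective prefix_component.
Proof.
move=> i j ij; apply/val_inj/eqP; rewrite eqn_leq !prefix_component_le //.
  by rewrite ij inE.
by rewrite -ij inE.
Qed.

(** Raising the bound on labels only adds edges, so a common point joins both components in the
    larger prefix. *)
Lemma prefix_component_nested i j : i <= j ->
  prefix_component i :&: prefix_component j != set0 ->
  prefix_component i \subset prefix_component j.
Proof.
move=> lij /set0Pn[x]; rewrite !inE => /andP[ix jx].
have mono a b : connect (prefix_adj i) a b -> connect (prefix_adj j) a b.
  apply: connect_sub => c d /and3P[ci di cd]; apply: connect1.
  by rewrite /prefix_adj cd !(leq_trans _ lij).
apply/subsetP => y; rewrite !inE => iy; apply: connect_trans jx (mono _ _ _).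
by apply: connect_trans iy; rewrite (sym_connect_sym (@prefix_adj_sym i)).
Qed.

(** The prefix components are [n] distinct vertices, and any two that meet are nested. *)
Lemma card_maximum_ge M : maximum_independent (ideal_graph le) M -> n <= #|M|.
Proof.
case=> _ maxM.
have cardP : #|prefix_component @: setT| = n.
  by rewrite card_imset ?cardsT ?card_ord //; apply: prefix_component_inj.
apply: (leq_trans (eq_leq (esym cardP))); apply: maxM; split.
  by apply/subsetP => _ /imsetP[i _ ->]; apply: prefix_component_connected.
move=> _ _ /imsetP[i _ ->] /imsetP[j _ ->].
apply/negP => /and3P[_ _ /and3P[ne ns1 ns2]].
case/orP: (leq_total i j) => lij.
  by case/negP: ns1; apply: prefix_component_nested.
by case/negP: ns2; apply: prefix_component_nested; rewrite // setIC.
Qed.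

(** * Labels of members and covering in the forest *)

Section MaximumIndependent.

Variable M : {set {set 'I_n}}.
Hypothesis M_max : maximum_independent (ideal_graph le) M.

Lemma maximum_vert J : J \in M -> J \in V.
Proof. by case: M_max => [[/subsetP sM _] _]; apply: sM. Qed.

Lemma maximum_nested A B : A \in M -> B \in M -> A :&: B != set0 ->
  A \subset B \/ B \subset A.
Proof.
move=> AM BM; apply: nonadj_nested; rewrite ?maximum_vert //.
by case: M_max => [[_ ind] _]; apply: ind.
Qed.

Lemma mem_mu J x :
  reflect (exists2 A, (A \in M) && (A \proper J) & x \in A) (x \in mu M J).
Proof. exact: bigcupP. Qed.

Lemma sub_mu A J : A \in M -> A \proper J -> A \subset mu M J.
Proof. by move=> AM AJ; apply/subsetP => x xA; apply/mem_mu; exists A; rewrite ?AM. Qed.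

(** A largest member of [M] strictly inside [J] and its complement in [mu M J]
    would split [J]. *)
Lemma setD_mu_nonempty J : J \in M -> J :\: mu M J != set0.
Proof.
move=> JM; rewrite setD_eq0; apply/negP => sJ.
have JV := maximum_vert JM; have [x xJ] := ideal_nonempty JV.
have /mem_mu[A0 A0P _] := subsetP sJ x xJ.
pose P A := (A \in M) && (A \proper J).
case: (@arg_maxnP _ A0 P (fun A => #|A|) A0P) => A /andP[AM AJ] Amax.
have AV := maximum_vert AM.
have /connected_idealsP[idA _ _] := AV.
have /connected_idealsP[idJ _ uJ] := JV.
(* A violation would give a member [B] of [M] that meets [A], but neither strictly contains it, by
   the choice of [A], nor lies in it, because of [i]. *)
have idL : order_ideal le (J :\: A).
  apply/order_idealP => i j /setDP[iJ iA] ji.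
  have /order_idealP/(_ i j iJ ji) jJ := idJ.
  rewrite inE jJ andbT; apply/negP => jA.
  have /mem_mu[B /andP[BM BJ] iB] := subsetP sJ i iJ.
  have /connected_idealsP[/order_idealP idB _ _] := maximum_vert BM.
  case: (@maximum_nested A B AM BM).
  - by apply/set0Pn; exists j; rewrite inE jA (idB i).
  - move=> sAB; have : #|A| < #|B|.
      by apply: proper_card; apply/properP; split=> //; exists i.
    by apply/negP; rewrite -leqNgt; apply: Amax; rewrite /P BM.
  by move=> /subsetP/(_ i iB); rewrite (negPf iA).
case: (uJ A (J :\: A) idA idL).
- by rewrite -setI_eq0; apply/eqP/setP => z; rewrite !inE; case: (z \in A).
- by apply/subsetP => z zJ; rewrite !inE zJ andbT orbN.
- by move=> sJA; rewrite properE sJA andbF in AJ.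
have [y yA] := ideal_nonempty AV.
move=> /subsetP/(_ y (subsetP (proper_sub AJ) y yA)).
by rewrite inE yA.
Qed.

(** Members sharing [x] are nested, and a strictly smaller one would put [x] into [mu] of the
    other. *)
Lemma setD_mu_disjoint A B x : A \in M -> B \in M ->
  x \in A :\: mu M A -> x \in B :\: mu M B -> A = B.
Proof.
move=> AM BM /setDP[xA xnA] /setDP[xB xnB]; apply/eqP.
case: (@maximum_nested A B AM BM); first by apply/set0Pn; exists x; rewrite inE xA.
  rewrite subEproper => /orP[//|p].
  by rewrite (subsetP (sub_mu AM p)) in xnB.
rewrite subEproper => /orP[|p]; first by rewrite eq_sym.
by rewrite (subsetP (sub_mu BM p)) in xnA.
Qed.

(** The sets [J :\: mu M J] are at least [n] nonempty disjoint subsets of an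
    [n]-element set. *)
Lemma setD_mu_singleton J : J \in M -> exists i, J :\: mu M J = [set i].
Proof.
move=> JM; pose D A := A :\: mu M A.
have injD : {in M &, injective D}.
  move=> A B AM BM eAB; have /set0Pn[x xA] := setD_mu_nonempty AM.
  by apply: (@setD_mu_disjoint A B x) => //; rewrite -/(D B) -eAB.
have tr : trivIset (D @: M).
  apply/trivIsetP => _ _ /imsetP[A AM ->] /imsetP[B BM ->] neAB.
  rewrite -setI_eq0; apply: contraNT neAB => /set0Pn[x /setIP[xA xB]].
  by rewrite (@setD_mu_disjoint A B x).
have sumn : \sum_(A in M) #|D A| <= n.
  rewrite -(big_imset (fun S : {set 'I_n} => #|S|) injD) /=.
  rewrite (eqP tr); apply: leq_trans (max_card _) _; by rewrite card_ord.
have D1 A : A \in M -> 0 < #|D A|.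
  by move=> AM; rewrite card_gt0 setD_mu_nonempty.
suff /cards1P : #|D J| == 1 by [].
rewrite eqn_leq D1 // andbT leqNgt; apply/negP => D2.
suff : n < \sum_(A in M) #|D A| by rewrite ltnNge sumn.
(* One summand at least 2 and the others at least 1 push the sum above [#|M|]. *)
apply: leq_ltn_trans (card_maximum_ge M_max) _.
rewrite -sum1_card (bigD1 J) //= [X in _ < X](bigD1 J) //= -addSn.
apply: leq_add => //; by apply: leq_sum => A /andP[AM _]; apply: D1.
Qed.

Lemma ideal_ofE J i : J \in M -> J :\: mu M J = [set i] -> ideal_of M i = J.
Proof.
move=> JM Ji; rewrite /ideal_of; case: pickP => [A /andP[AM /eqP Ai] | /(_ J)] /=.
  by apply: (@setD_mu_disjoint A J i); rewrite // ?Ai ?Ji inE.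
by rewrite JM Ji eqxx.
Qed.

(** Strict containment in [ideal_of M i] excludes the default value [set0]. *)
Lemma ideal_of_proper J i : J \proper ideal_of M i ->
  ideal_of M i \in M /\ ideal_of M i :\: mu M (ideal_of M i) = [set i].
Proof.
rewrite /ideal_of; case: pickP => [A /andP[AM /eqP Ai] _ //|_] /=.
by rewrite properE sub0set andbF.
Qed.

(** Since every member of [M] has a label, covering can be tested on members instead of labels. *)
Lemma covered_by_forestP J i j : J \in M -> J :\: mu M J = [set i] ->
  reflect (exists K, [/\ K \in M, K :\: mu M K = [set j], J \proper K &
            forall L, L \in M -> J \proper L -> ~~ (L \proper K)])
          (covered_by (forest_lt M) i j).
Proof.
move=> JM Ji; rewrite /covered_by /forest_lt (ideal_ofE JM Ji).
apply: (iffP andP) => [[pJ /existsPn nk]|[K [KM Kj pJK nL]]].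
  have [KM Kj] := ideal_of_proper pJ; exists (ideal_of M j); split=> // L LM pL.
  have [k Lk] := setD_mu_singleton LM.
  by have := nk k; rewrite (ideal_ofE LM Lk) pL.
rewrite (ideal_ofE KM Kj); split=> //; apply/existsPn => k; apply/andP => -[pk].
by have [LM _] := ideal_of_proper pk; apply/negP/nL.
Qed.

Lemma isolated_not_Des J i : J \in M -> isolated J ->
  J :\: mu M J = [set i] -> i \notin Des M.
Proof.
move=> JM isoJ Ji; rewrite inE; apply/existsPn => j.
apply/andP => -[/(covered_by_forestP _ JM Ji)[K [KM Kj pJK nL]] ji].
have JV := maximum_vert JM; have KV := maximum_vert KM.
have /connected_idealsP[idJ _ _] := JV.
have /connected_idealsP[idK _ uK] := KV.
have /setDP[jK jmu] : j \in K :\: mu M K by rewrite Kj inE.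
have /setDP[iJ _] : i \in J :\: mu M J by rewrite Ji inE.
have jJ : j \notin J by apply: contra jmu; apply/subsetP/sub_mu.
(* Otherwise [J] and [K :\: J] would split [K]: an element of [K :\: J] other than [j] and above a
   point of [J] would lie in a member strictly between [J] and [K]. *)
have /existsP[u /andP[uJ uj]] : [exists u, (u \in J) && le u j].
  apply: contraT => /existsPn nu.
  have idL : order_ideal le (K :\: J).
    apply/order_idealP => y z /setDP[yK yJ] zy.
    have /order_idealP/(_ y z yK zy) zK := idK.
    rewrite inE zK andbT; apply/negP => zJ.
    have [yj|nyj] := eqVneq y j; first by have := nu z; rewrite zJ -yj zy.
    have /mem_mu[E /andP[EM pEK] yE] : y \in mu M K.
      apply/negPn/negP => ymu; have : y \in K :\: mu M K by rewrite inE ymu.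
      by rewrite Kj inE (negPf nyj).
    have /connected_idealsP[/order_idealP idE _ _] := maximum_vert EM.
    case: (@maximum_nested J E JM EM).
    - by apply/set0Pn; exists z; rewrite inE zJ (idE y).
    - move=> sJE; have pJE : J \proper E by apply/properP; split=> //; exists y.
      by have := nL E EM pJE; rewrite pEK.
    by move=> /subsetP/(_ y yE); rewrite (negPf yJ).
  case: (uK J (K :\: J) idJ idL).
  - by rewrite -setI_eq0; apply/eqP/setP => z; rewrite !inE; case: (z \in J).
  - by apply/subsetP => z zK; rewrite !inE zK andbT orbN.
  - by move=> s; rewrite properE s andbF in pJK.
  by move=> /subsetP/(_ i (subsetP (proper_sub pJK) i iJ)); rewrite inE iJ.
(* If [J] lies below [j], then [i <= j], against the descent; the reverse inclusion would put [j] in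
   [J]. *)
case: (isolated_nested isoJ (principal_ideal_connected j)).
- by apply/set0Pn; exists u; rewrite !inE uJ.
- move=> /subsetP/(_ i iJ); rewrite inE => /le_natural.
  by rewrite leqNgt ji.
by move=> /subsetP/(_ j); rewrite inE le_refl (negPf jJ) => /(_ isT).
Qed.

End MaximumIndependent.

(** ** Two maximum independent sets with the same trace on a component *)

Section SameTrace.

Variable E0 : {set 'I_n}.
Hypotheses (E0V : E0 \in V) (E0_niso : ~ isolated E0).

Local Notation U := (component_union E0).

Let U_iso : isolated U. Proof. exact: component_union_isolated. Qed.

Lemma component_not_isolated J : connect adj E0 J -> ~ isolated J.
Proof.
move=> E0J isoJ; apply: E0_niso; suff -> : E0 = J by [].
by apply: isolated_connect isoJ _; rewrite adj_connect_sym.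
Qed.

Lemma component_union_sub J K : connect adj E0 J -> K \in V ->
  ~~ connect adj E0 K -> J \subset K -> U \subset K.
Proof.
move=> E0J KV nK sJK; apply/bigcupsP => F E0F.
have JV := connect_adj_vert E0V E0J.
apply: (@component_sub J) => //; first by apply: contra nK; apply: connect_trans.
by apply: connect_trans E0F; rewrite adj_connect_sym.
Qed.

Variables M1 M2 : {set {set 'I_n}}.
Hypotheses (M1_max : maximum_independent (ideal_graph le) M1)
           (M2_max : maximum_independent (ideal_graph le) M2).
Hypothesis same_trace : forall J, connect adj E0 J -> (J \in M1) = (J \in M2).

(** One inclusion suffices by symmetry. A member of [M1] outside the component may be missing from
    [M2]; the union of its own component replaces it. *)
Lemma mu_sub_same_trace J : connect adj E0 J \/ J = U ->
  mu M1 J \subset mu M2 J.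
Proof.
move=> CJ; have JV : J \in V.
  by case: CJ => [/(connect_adj_vert E0V) //|->]; case: U_iso.
apply/subsetP => x /mem_mu[E /andP[EM pEJ] xE].
have EV := maximum_vert M1_max EM; have sEJ := proper_sub pEJ.
have [E0E|nE0E] := boolP (connect adj E0 E).
  by apply/mem_mu; exists E; rewrite ?pEJ // -same_trace ?EM.
have [isoUE inUE] := (component_union_isolated EV, sub_component_union (connect0 adj E)).
suff pUJ : component_union E \proper J.
  by apply/mem_mu; exists (component_union E); rewrite ?pUJ ?isolated_in_maximum ?(subsetP inUE).
(* Equality would make [K] isolated, which no vertex of the component of [E0] is. *)
have nest K : connect adj E0 K -> E \subset K -> component_union E \proper K.
  move=> E0K sEK; rewrite properEneq; apply/andP; split.
    by apply/eqP => eK; apply: (component_not_isolated E0K); rewrite -eK.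
  apply/bigcupsP => F EF; apply: (@component_sub E) => //.
    exact: connect_adj_vert E0K.
  by apply: contra nE0E => EK; apply: connect_trans E0K _; rewrite adj_connect_sym.
case: CJ => [E0J|eJ]; first exact: nest.
(* For [J = U], a vertex [B] of the component through [x] is nested with [E]; here [B \subset E]
   would force [U \subset E]. *)
have /bigcupP[B E0B xB] : x \in U by rewrite -eJ (subsetP sEJ).
have BV := connect_adj_vert E0V E0B.
case: (@nonadj_nested E B EV BV).
- by apply: contra nE0E => EB; apply: connect_trans E0B _; rewrite adj_connect_sym connect1.
- by apply/set0Pn; exists x; rewrite inE xE.
- by move=> /(nest B E0B) p; rewrite eJ (proper_sub_trans p) // sub_component_union.
move=> sBE; rewrite eJ properE in pEJ.
by case/andP: pEJ => _ /negP[]; apply: component_union_sub sBE.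
Qed.

End SameTrace.

Lemma Des_same_trace E0 M1 M2 J i : E0 \in V ->
  maximum_independent (ideal_graph le) M1 ->
  maximum_independent (ideal_graph le) M2 ->
  (forall F, connect adj E0 F -> (F \in M1) = (F \in M2)) ->
  connect adj E0 J -> J \in M1 -> J :\: mu M1 J = [set i] -> i \in Des M1 ->
  i \in Des M2 /\ J :\: mu M2 J = [set i].
Proof.
move=> E0V M1_max M2_max tr E0J JM1 Ji iD.
(* An isolated [E0] would be the only vertex of its component, and its label is never a descent. *)
have E0_niso : ~ isolated E0.
  move=> iso; have eJ := isolated_connect iso E0J.
  by move: iD; apply/negP; apply: (isolated_not_Des M1_max JM1); rewrite ?eJ // -?eJ.
have muE K : connect adj E0 K \/ K = component_union E0 -> mu M1 K = mu M2 K.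
  move=> CK; apply/eqP; rewrite eqEsubset !(@mu_sub_same_trace E0) // => F E0F.
  by rewrite tr.
have U_iso := component_union_isolated E0V.
have UM M : maximum_independent (ideal_graph le) M -> component_union E0 \in M.
  by move=> M_max; apply: isolated_in_maximum.
have JM2 : J \in M2 by rewrite -tr.
have Ji2 : J :\: mu M2 J = [set i] by rewrite -muE //; left.
have pJU : J \proper component_union E0.
  rewrite properEneq sub_component_union // andbT; apply/eqP => eJ.
  by apply: (component_not_isolated E0_niso E0J); rewrite eJ.
split=> //; move: iD; rewrite !inE => /existsP[j /andP[cov ji]].
apply/existsP; exists j; rewrite ji andbT.
have /(covered_by_forestP M1_max _ JM1 Ji)[K [KM1 Kj pJK nL]] := cov.
(* Outside the component, [K] contains the union; were it larger, the union would lie strictly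
   between [J] and [K]. *)
have CK : connect adj E0 K \/ K = component_union E0.
  have [E0K|nE0K] := boolP (connect adj E0 K); [by left | right; apply/eqP].
  have sUK := component_union_sub E0V E0J (maximum_vert M1_max KM1) nE0K (proper_sub pJK).
  by have := nL _ (UM _ M1_max) pJU; rewrite properEneq sUK andbT negbK eq_sym.
have KM2 : K \in M2 by case: CK => [E0K|->]; [rewrite -tr | apply: UM].
apply/(covered_by_forestP M2_max _ JM2 Ji2); exists K; split=> //.
  by rewrite -muE.
move=> L LM2 pJL; have [E0L|nE0L] := boolP (connect adj E0 L).
  by apply: nL => //; rewrite tr.
(* Such an [L] contains the union and hence [K]. *)
have sUL := component_union_sub E0V E0J (maximum_vert M2_max LM2) nE0L (proper_sub pJL).
have sKU : K \subset component_union E0 by case: CK => [/sub_component_union|->].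
by rewrite properE (subset_trans sKU sUL) andbF.
Qed.

End IdealGraph.

Theorem theorem1p2 (n : nat) (le : rel 'I_n)
    (le_po : partial_order le) (le_nat : naturally_labeled le)
    (C : {set {set 'I_n}}) (C_comp : C \in component_sets (ideal_graph le))
    (Mr : {set {set 'I_n}})
    (Mr_max : maximum_independent (induced (ideal_graph le) C) Mr)
    (M1 M2 : {set {set 'I_n}})
    (M1_max : maximum_independent (ideal_graph le) M1)
    (M2_max : maximum_independent (ideal_graph le) M2)
    (M1_Mr : M1 :&: C = Mr) (M2_Mr : M2 :&: C = Mr) :
  Des_rel Mr M1 = Des_rel Mr M2 /\ Desbar_rel Mr M1 = Desbar_rel Mr M2.
Proof.
have [E0 E0V eC] : exists2 E0, E0 \in connected_ideals le &
    C = [set F in connected_ideals le | connect (edge (ideal_graph le)) E0 F].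
  by case/imsetP: C_comp => E0 E0V eC; exists E0.
have key M M' : maximum_independent (ideal_graph le) M ->
    maximum_independent (ideal_graph le) M' -> M :&: C = Mr -> M' :&: C = Mr ->
    forall J i, J \in Mr -> J :\: mu M J = [set i] -> i \in Des M ->
    i \in Des M' /\ J :\: mu M' J = [set i].
  move=> M_max M'_max MC M'C J i; rewrite -{1}MC => /setIP[JM].
  rewrite eC inE => /andP[_ E0J] Ji iD.
  apply: (Des_same_trace le_po le_nat E0V M_max M'_max _ E0J JM Ji iD) => F E0F.
  have FC : F \in C by rewrite eC inE E0F (connect_adj_vert E0V E0F).
  by have := congr1 (fun S : {set _} => F \in S) (etrans MC (esym M'C)); rewrite !inE FC !andbT.
(* Inclusions for an arbitrary ordered pair, so that exchanging [M1] and [M2] yields the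
   equalities. *)
have subD M M' : maximum_independent (ideal_graph le) M ->
    maximum_independent (ideal_graph le) M' -> M :&: C = Mr -> M' :&: C = Mr ->
    Des_rel Mr M \subset Des_rel Mr M' /\ Desbar_rel Mr M \subset Desbar_rel Mr M'.
  move=> M_max M'_max MC M'C.
  have k := key M M' M_max M'_max MC M'C.
  have s : Des_rel Mr M \subset Des_rel Mr M'.
    apply/subsetP => i => /setIdP[iD /exists_inP[J JMr /eqP Ji]].
    have [iD' Ji'] := k J i JMr (esym Ji) iD.
    by apply/setIdP; split=> //; apply/exists_inP; exists J; rewrite // Ji'.
  split=> //; apply/subsetP => J /setIdP[JMr /exists_inP[i iD /eqP Ji]].
  apply/setIdP; split=> //; apply/exists_inP; exists i; first exact: (subsetP s).
  have iDM : i \in Des M by case/setIdP: iD.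
  by have [_ ->] := k J i JMr Ji iDM.
have [s1 t1] := subD _ _ M1_max M2_max M1_Mr M2_Mr.
have [s2 t2] := subD _ _ M2_max M1_max M2_Mr M1_Mr.
by split; apply/eqP; rewrite eqEsubset ?s1 ?t1.
Qed.
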